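(* For general families of bottomless rectangles, $m_k^*(\mathcal{F}_{\sqcap})\ge 2k-1$ for every positive integer $k$.
   Context: A (closed) bottomless rectangle is a subset of $\mathbb{R}^2$ of the form $\{(x,y): l\le x\le r,\ y\le t\}$. $\mathcal{F}_{\sqcap}$ denotes the family of all bottomless rectangles in the plane. $m_k^*(\mathcal{F}_{\sqcap})$ is the smallest number $m$ such that every finite subfamily of $\mathcal{F}_{\sqcap}$ can be $k$-coloured so that every point of $\mathbb{R}^2$ covered by at least $m$ members of the subfamily is covered by members of all $k$ colours. *)

(* Defs.v *)
From HB Require Import structures.
From mathcomp Require Import all_boot all_order all_algebra finmap.
From mathcomp Require Import all_classical all_reals ereal.

Set Implicit Arguments.
Unset Strict Implicit.
Unset Printing Implicit Defensive.

Import Order.TTheory GRing.Theory Num.Theory.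

Local Open Scope classical_set_scope.
Local Open Scope fset_scope.
Local Open Scope ring_scope.

Definition bottomless_rectangles (R : realType) : set (set (R * R)) :=
  [set S | exists l r t : R, S = [set p | l <= p.1 <= r /\ p.2 <= t]].

(* A subfamily is a finite set of members, so members are pairwise distinct
   subsets of X. *)
Definition depth (X : Type) (B : {fset (set X)}) (p : X) : nat :=
  #|` [fset S in B | p \in S]|.

(* Only the values of c on B matter; c is total on [set X] because the number
   k of colours is positive wherever this is used. *)
Definition polychromatic (X : Type) (k m : nat) (B : {fset (set X)})
    (c : set X -> 'I_k) : Prop :=
  forall p : X, (m <= depth B p)%N ->
    forall i : 'I_k, exists2 S : set X, S \in B & S p /\ c S = i.

Definition colourable_depth (X : Type) (k : nat) (F : set (set X)) (m : nat) :
    Prop :=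
  forall B : {fset (set X)}, (forall S, S \in B -> F S) ->
    exists c : set X -> 'I_k, polychromatic m B c.

(* The smallest admissible depth, with value +oo when there is none. *)
Definition mstar (R : realType) (X : Type) (k : nat) (F : set (set X)) :
    \bar R :=
  ereal_inf [set (m%:R)%:E | m in colourable_depth k F].

Lemma mstarE (R : realType) (X : Type) (k : nat) (F : set (set X)) (m : nat) :
  colourable_depth k F m ->
  (forall m', colourable_depth k F m' -> (m <= m')%N) ->
  mstar R k F = (m%:R)%:E.
Proof.
move=> Fm mmin; apply/eqP; rewrite eq_le; apply/andP; split.
  by apply: ereal_inf_lbound; exists m.
by apply: le_ereal_inf_tmp => _ [m' Fm' <-]; rewrite lee_fin ler_nat mmin.
Qed.

(* Main.v *)
Require Import Defs.
From mathcomp Require Import all_boot all_order all_algebra.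
From mathcomp Require Import all_classical all_reals ereal.
From mathcomp Require Import finmap zify lra.

Set Implicit Arguments.
Unset Strict Implicit.
Unset Printing Implicit Defensive.

Import Order.TTheory GRing.Theory Num.Theory.

Local Open Scope ring_scope.

(** Write k + 1 for the number of colours.  By induction on k there is a finite
    family such that every colouring leaves some point of depth at least 2k
    that misses a colour; so depth 2k is not enough for k + 1 colours.
    For k = 0 the empty family works.

    For the step to k + 2 colours, take a rectangle X and a staircase of
    n = 2k + 2 rectangles Y_0, ..., Y_(n-1): all of them share their right side,
    which lies to the right of X, while their left sides move to the left and
    their tops move down as the index grows.  Then
    - to the right of X, low enough, is a point that lies in all the Y_j and not
      in X;
    - for each j there is an open box whose points lie in X and in Y_j but in
      no other Y_i: left of the left side of Y_i for i < j, and above the top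
      of Y_i for i > j.
    In that j-th box place a copy G_j of the family for k + 1 colours.

    Given a colouring c, suppose first that c X = c (Y_j) for some j.  Merge
    the colour c X into some other colour, which leaves k + 1 colours: G_j
    provides a point of the box with depth 2k in G_j that misses a colour other
    than c X.  Adding X and Y_j, which both have colour c X, raises its depth to
    2k + 2, and it still misses that colour.  If instead no Y_j has the
    colour of X, then the point outside X, of depth n = 2k + 2, misses c X.

    This is [forcing_family]; the bound on [mstar] is its instance with as many
    colours as required. *)

Definition bottomless (R : realType) (l r t : R) : set (R * R) :=
  [set p | l <= p.1 <= r /\ p.2 <= t]%classic.

Lemma bottomlessP (R : realType) (l r t : R) :
  bottomless_rectangles (bottomless l r t).
Proof. by exists l, r, t. Qed.

(** Supplies the coordinates of the staircase and of its boxes inside a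
    prescribed open interval. *)
Lemma decreasing_seq_in (R : realType) (x y : R) : x < y ->
  exists u : nat -> R,
    (forall i, x < u i < y) /\ {mono u : i j / (i <= j)%N >-> j <= i}.
Proof.
move=> xy; exists (fun i => x + (y - x) / i.+2%:R).
have d0 : 0 < y - x by rewrite subr_gt0.
split=> [i|i j].
  rewrite ltrDl divr_gt0 ?ltr0n //= -ltrBrDl ltr_pdivrMr ?ltr0n //.
  by rewrite ltr_pMr // ltr1n.
by rewrite lerD2l ler_pM2l // lef_pV2 ?posrE ?ltr0n // ler_nat.
Qed.

Lemma leq_depth (X : Type) (B D : {fset (set X)}) (p : X) :
  (D `<=` B)%fset -> (forall S, S \in D -> S p) -> (#|` D| <= depth B p)%N.
Proof.
move=> /fsubsetP DB Dp; apply/fsubset_leq_card/fsubsetP => S SD.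
by rewrite !inE /= DB //= mem_set //; exact: Dp.
Qed.

(** The induction needs copies of the family inside the boxes of the staircase.
    Hence the witness point is confined to a prescribed open box, and so are
    the members, but only horizontally: rectangles reaching above the box do
    no harm, whereas the bad point of one copy must avoid all other copies,
    which are separated from it by vertical lines. *)
Lemma forcing_family (R : realType) (k : nat) (x0 x1 y0 y1 : R) :
  x0 < x1 -> y0 < y1 ->
  exists B : {fset (set (R * R))},
    (forall S, S \in B ->
       bottomless_rectangles S /\ forall p, S p -> x0 < p.1 < x1) /\
    forall c : set (R * R) -> 'I_k.+1, exists p i,
      [/\ x0 < p.1 < x1, y0 < p.2 < y1, (2 * k <= depth B p)%N
        & forall S, S \in B -> S p -> c S <> i].
Proof.
elim: k x0 x1 y0 y1 => [|k IHk] x0 x1 y0 y1 x01 y01.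
  exists fset0; split=> [S|c]; first by rewrite inE.
  exists ((x0 + x1) / 2, (y0 + y1) / 2), ord0 => /=.
  by split; rewrite ?muln0 //; try lra; move=> S; rewrite inE.
have [u [ux umono]] := decreasing_seq_in x01.
have [v [vy vmono]] := decreasing_seq_in y01.
have ult i j : (u i < u j) = (j < i)%N by rewrite ltNge umono -ltnNge.
have vlt i j : (v i < v j) = (j < i)%N by rewrite ltNge vmono -ltnNge.
pose n := (2 * k.+1)%N.
pose X := bottomless (u n.+1) (u 1%N) (v 0%N).
pose Y (j : nat) := bottomless (u j.+2) (u 0%N) (v j).
(* The j-th box: its points lie in X and Y_j, and in no other Y_i. *)
have /choice[G GP] : forall j : nat, exists B : {fset (set (R * R))},
    (forall S, S \in B ->
       bottomless_rectangles S /\ forall p, S p -> u j.+2 < p.1 < u j.+1) /\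
    forall c : set (R * R) -> 'I_k.+1, exists p i,
      [/\ u j.+2 < p.1 < u j.+1, v j.+1 < p.2 < v j, (2 * k <= depth B p)%N
        & forall S, S \in B -> S p -> c S <> i].
  by move=> j; apply: IHk; rewrite ?ult ?vlt.
have Gin j S p : S \in G j -> S p -> u j.+2 < p.1 < u j.+1.
  by move=> SG; have [_] := (GP j).1 S SG; apply.
have Ycorner i j : (i <= j)%N -> Y i (u 0%N, v j).
  by move=> ij; split; rewrite /= ?umono ?vmono ?lexx.
have notG j S p : S p -> u j.+1 <= p.1 -> S \notin G j.
  by move=> Sp jp; apply/negP => /Gin/(_ Sp)/andP[_]; rewrite ltNge jp.
pose Ys := [fset Y j | j in iota 0 n]%fset.
pose B := (X |` (Ys `|` \bigcup_(j <- iota 0 n) G j))%fset.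
have inB S : S \in B -> [\/ S = X, exists2 j, (j < n)%N & S = Y j
                         | exists2 j, (j < n)%N & S \in G j].
  rewrite in_fset1U in_fsetU => /or3P[/eqP->|/imfsetP[j]|/bigfcupP[j]].
  - by constructor 1.
  - by rewrite mem_iota => jn ->; constructor 2; exists j.
  - by rewrite mem_iota andbT => jn SG; constructor 3; exists j.
have XB : X \in B by rewrite !inE eqxx.
have YsB : (Ys `<=` B)%fset.
  by apply: fsubset_trans (fsubsetUr _ _); exact: fsubsetUl.
have YYs j : (j < n)%N -> Y j \in Ys.
  by move=> jn; apply/imfsetP; exists j; rewrite // mem_iota.
have GB j : (j < n)%N -> (G j `<=` B)%fset.
  move=> jn; apply: fsubset_trans (fsubsetUr _ _).
  apply: fsubset_trans (fsubsetUr _ _).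
  by apply: bigfcup_sup; rewrite // mem_iota.
exists B; split.
  move=> S /inB[->|[j _ ->]|[j _ SG]].
  - split=> [|p [/andP[lp pr] _]]; first exact: bottomlessP.
    by have := ux n.+1; have := ux 1%N; lra.
  - split=> [|p [/andP[lp pr] _]]; first exact: bottomlessP.
    by have := ux j.+2; have := ux 0%N; lra.
  - split=> [|p]; first by have [] := (GP j).1 S SG.
    move=> /(Gin _ _ _ SG); have := ux j.+2; have := ux j.+1; lra.
move=> c.
have [/hasP[j]|] := boolP (has (fun j => c (Y j) == c X) (iota 0 n)).
  rewrite mem_iota /= => jn /eqP cYX.
  (* Recolouring by unlift merges the colour of X into the one that becomes ord0;
     a missing colour i then stands for lift (c X) i, distinct from c X. *)
  have [_ /(_ (fun S => odflt ord0 (unlift (c X) (c S))))] := GP j.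
  move=> [p [i [px py pdepth pmiss]]].
  have Xp : X p.
    have : u n.+1 <= u j.+2 by rewrite umono ltnS.
    have : u j.+1 <= u 1%N by rewrite umono.
    have : v j <= v 0%N by rewrite vmono.
    by split; lra.
  have Yp : Y j p.
    by have : u j.+1 <= u 0%N by [rewrite umono]; split; lra.
  exists p, (lift (c X) i); split.
  - by have := ux j.+2; have := ux j.+1; lra.
  - by have := vy j.+1; have := vy j; lra.
  - have YnG : Y j \notin G j.
      by apply: (notG _ _ (u 0%N, v j)); rewrite /= ?umono //; exact: Ycorner.
    have XnG : X \notin G j.
      apply: (notG _ _ (u 1%N, v 0%N)); rewrite /= ?umono //.
      by split; rewrite /= ?umono ?lexx.
    have XnY : X != Y j.
      apply/eqP => XY; have := Ycorner j j (leqnn j).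
      by rewrite -XY => -[/= /andP[_]]; rewrite umono.
    pose D := [fset S in G j | p \in S]%fset.
    have -> : (2 * k.+1 = 1 + (1 + 2 * k))%N by lia.
    apply: leq_trans (leq_depth (D := (X |` (Y j |` D))%fset) _ _).
    + rewrite cardfsU1 cardfsU1 !inE /= (negbTE XnG) (negbTE YnG) (negbTE XnY).
      by rewrite !leq_add2l.
    + rewrite !fsubUset !fsub1set XB (fsubsetP YsB _ (YYs j jn)) /=.
      by apply: fsubset_trans (GB j jn); exact: fset_sub.
    + move=> S; rewrite !in_fset1U => /or3P[/eqP->|/eqP->|] //.
      by rewrite inE /= => /andP[_ /set_mem].
  - move=> S /inB[->|[i' _ ->]|[i' _ SG]] Sp.
    + exact/eqP/neq_lift.
    + have -> : i' = j.
        case: Sp => /andP[lp _] pt.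
        have : u i'.+2 < u j.+1 by lra.
        have : v j.+1 < v i' by lra.
        by rewrite ult vlt; lia.
      by rewrite cYX; exact/eqP/neq_lift.
    + have ij : i' = j.
        have p' := Gin _ _ _ SG Sp.
        have : u i'.+2 < u j.+1 by lra.
        have : u j.+2 < u i'.+1 by lra.
        by rewrite !ult; lia.
      rewrite {}ij in SG.
      by move=> cS; apply: (pmiss S SG Sp); rewrite cS liftK.
move=> /hasPn cYX.
exists (u 0%N, v n), (c X); split; [exact: ux|exact: vy| |].
- have cardYs : #|` Ys| = n.
    rewrite -[RHS](size_iota 0) -[in RHS](undup_id (iota_uniq 0 n)).
    apply: card_in_imfset => i j _ _ YY.
    have Ycor h : Y h (u h.+2, v h) by split; rewrite /= ?umono ?leqnn ?lexx.
    have [/andP[ij _] _] : Y j (u i.+2, v i) by rewrite -YY.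
    have [/andP[ji _] _] : Y i (u j.+2, v j) by rewrite YY.
    by move: ij ji; rewrite /= !umono; lia.
  rewrite -[X in (X <= _)%N]cardYs; apply: leq_depth => // S /imfsetP[j].
  rewrite mem_iota => jn ->.
  by apply: Ycorner; lia.
- move=> S /inB[->|[j jn ->]|[j _ SG]] Sq.
  + by case: Sq => /andP[_] /=; rewrite umono.
  + by apply/eqP/cYX; rewrite mem_iota.
  + by have /andP[_] := Gin _ _ _ SG Sq; rewrite /= ult.
Qed.

Theorem theorem4p2 (R : realType) (k : nat) (hk : (0 < k)%N) :
  (((2 * k - 1)%N%:R)%:E <= mstar R k (@bottomless_rectangles R))%E.
Proof.
apply: le_ereal_inf_tmp => _ [m colm <-]; rewrite lee_fin ler_nat.
case: k hk colm => // k _ colm; rewrite leqNgt; apply/negP => mk.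
have [B [BF Bforce]] := forcing_family k (@ltr01 R) (@ltr01 R).
have [S /BF[]//|c cpoly] := colm B.
have [p [i [_ _ pdepth pmiss]]] := Bforce c.
have [|S SB [Sp cS]] := cpoly p _ i; first by apply: leq_trans pdepth; lia.
exact: pmiss SB Sp cS.
Qed.
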